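(* Let $n\ge 4$ be an integer. Let $\sigma$ be the permutation of $\{1,2,\dots,n\}$ given in cycle notation by \[ \sigma= \begin{cases} (1\;2\;\ldots\;n-1)(n), & \text{if } n \text{ is even},\\ (1\;2\;\ldots\;k-1)(k)(k+1\;k+2\;\ldots\;n), & \text{if } n=2k-1 \text{ is odd}. \end{cases} \] Then $M(\sigma)$ is an Euler's magic matrix (over $\mathbb{Z}$).
   Context: For a permutation $\sigma$ of $\{1,2,\dots,n\}$, the matrix $M(\sigma)=(m_{i,j})\in\mathbb{Z}^{n\times n}$ is defined by $m_{i,j}=1$ if $j=\sigma(i)$ and $m_{i,j}=0$ otherwise. Let $R$ be a commutative ring and $n$ a positive integer. A matrix $M=(m_{i,j})_{1\le i,j\le n}\in R^{n\times n}$ is called an Euler's magic matrix over $R$ if there is some $\gamma\in R\setminus\{0\}$ such that (i) $M\cdot M^t=\gamma\cdot I_n$, where $M^t$ is the transpose of $M$ and $I_n$ is the $n\times n$ identity matrix; (ii) $\sum_{i=1}^n m_{i,i}^2=\gamma$; and (iii) $\sum_{i=1}^n m_{i,n+1-i}^2=\gamma$. *)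

(* Defs.v *)
From mathcomp Require Import all_boot all_order all_algebra all_fingroup.

Set Implicit Arguments.
Unset Strict Implicit.
Unset Printing Implicit Defensive.

Import GRing.Theory.
Local Open Scope ring_scope.

(* Rows and columns are numbered from 0, so [rev_ord i] is the index that
   the 1-based numbering writes n + 1 - i.  For n = 0 the predicate is false
   (the empty sum would force g = 0), in agreement with n being positive. *)
Definition euler_magic (R : comPzRingType) (n : nat) (M : 'M[R]_n) : Prop :=
  exists g : R,
    [/\ g != 0,
        M *m M^T = g%:M,
        \sum_(i < n) M i i ^+ 2 = g
      & \sum_(i < n) M i (rev_ord i) ^+ 2 = g].

(* The permutation (x_1 x_2 ... x_m) in cycle notation: it sends each entry of
   s = [:: x_1; ...; x_m] to the following one, x_m to x_1, and fixes all other
   points.  On a sequence without repetitions [undup] is the identity; it only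
   serves to make the definition total. *)
Definition cycle_perm (T : finType) (s : seq T) : {perm T} :=
  perm (can_inj (prev_next (undup_uniq s))).

(* The increasing list of the elements a, a + 1, ..., b of {1, ..., n}, where
   the element written i in the 1-based numbering is the ordinal of value
   i - 1. *)
Definition labels (n a b : nat) : seq 'I_n :=
  [seq i : 'I_n <- enum 'I_n | (a <= i.+1 <= b)%N].

(* For odd n, uphalf n = (n + 1) / 2 is the k such that n = 2 k - 1. *)
Definition sigma (n : nat) : 'S_n :=
  if odd n then
    let k := uphalf n in
    (cycle_perm (labels n 1 k.-1) * cycle_perm (labels n k k)
       * cycle_perm (labels n k.+1 n))%g
  else
    (cycle_perm (labels n 1 n.-1) * cycle_perm (labels n n n))%g.

(* The entries of the library's [perm_mx s] are those of M(s): 1 at (i, j) if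
   j = s i, and 0 otherwise (and not those of the transpose). *)
Lemma perm_mxE (R : pzSemiRingType) (n : nat) (s : 'S_n) (i j : 'I_n) :
  (perm_mx s : 'M[R]_n) i j = (j == s i)%:R.
Proof. by rewrite !mxE eq_sym. Qed.

(* Main.v *)
(* Any permutation matrix is orthogonal, so with gamma = 1 the two remaining
   conditions say that sigma has exactly one fixed point and that sigma(i) =
   n + 1 - i has exactly one solution i.  For n even these are n and n / 2; for
   n = 2 k - 1 both are k, because sigma preserves {1, ..., k - 1} and
   {k + 1, ..., n} whereas i |-> n + 1 - i exchanges them. *)
Require Import Defs.
From mathcomp Require Import all_boot all_order all_algebra all_fingroup.
From mathcomp Require Import zify.

Set Implicit Arguments.
Unset Strict Implicit.
Unset Printing Implicit Defensive.

Import GRing.Theory.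

Lemma next_iota a m i : a <= i < a + m ->
  next (iota a m) i = if i.+1 == a + m then a else i.+1.
Proof.
case: m => [|m] hi; first lia.
rewrite next_nth mem_iota hi /=.
(* The conditional is [index i (iota a m.+1)] after simplification. *)
have -> : (if a == i then 0 else (index i (iota a.+1 m)).+1) = i - a.
  rewrite -[LHS]/(index i (iota a m.+1)).
  have {1}-> : i = nth 0 (iota a m.+1) (i - a) by rewrite nth_iota; lia.
  by rewrite index_uniq ?iota_uniq // size_iota; lia.
(* At the last entry, position [i - a] overruns the tail, and [nth] returns its default [a]: the
   cycle closes up. *)
case: eqP => [hl|hl]; first by rewrite nth_default // size_iota; lia.
by rewrite nth_iota; lia.
Qed.

Lemma map_val_labels n a b : b <= n ->
  map val (labels n a.+1 b) = iota a (b - a).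
Proof.
move=> hb; rewrite /labels -(filter_map val (fun i => a < i.+1 <= b)).
rewrite val_enum_ord.
(* Strictly increasing lists with the same members are equal. *)
apply: (irr_sorted_eq ltn_trans ltnn).
- exact/(sorted_filter ltn_trans)/iota_ltn_sorted.
- exact: iota_ltn_sorted.
by move=> i; rewrite mem_filter !mem_iota; lia.
Qed.

Lemma cycle_perm_labelsE n a b (i : 'I_n) : b <= n ->
  cycle_perm (labels n a.+1 b) i =
    (if a <= i < b then if i.+1 == b then a else i.+1 else i) :> nat.
Proof.
move=> hb; have hu : uniq (labels n a.+1 b) by rewrite filter_uniq ?enum_uniq.
rewrite permE undup_id // -[LHS](next_map val_inj hu) map_val_labels //.
case: ifPn => hi; first by rewrite next_iota subnKC //; lia.
by rewrite next_nth mem_iota ifN //=; lia.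
Qed.

Lemma sum_indicator_sqr (R : pzSemiRingType) (T : finType) (P : pred T) (x : T) :
  P =1 pred1 x -> (\sum_i (P i)%:R ^+ 2 = 1 :> R)%R.
Proof.
move=> hP; rewrite (bigD1 x) //= hP /= eqxx expr1n big1 ?addr0 // => i hi.
by rewrite hP /= (negbTE hi) expr0n.
Qed.

Lemma euler_magic_perm_mx (R : comNzRingType) n (s : 'S_n) (x y : 'I_n) :
  (forall i, (s i == i) = (i == x)) ->
  (forall i, (s i == rev_ord i) = (i == y)) ->
  euler_magic (perm_mx s : 'M[R]_n).
Proof.
move=> hx hy; exists 1%R; split; first exact: oner_neq0.
- by rewrite tr_perm_mx -perm_mxM mulgV perm_mx1.
- under eq_bigr => i _ do rewrite perm_mxE eq_sym.
  exact: (sum_indicator_sqr _ hx).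
- under eq_bigr => i _ do rewrite perm_mxE eq_sym.
  exact: (sum_indicator_sqr _ hy).
Qed.

Lemma sigma_evenE n (i : 'I_n) : 0 < n -> ~~ odd n ->
  sigma n i = (if i.+2 < n then i.+1 else if i.+2 == n then 0 else i) :> nat.
Proof.
case: n i => // n i _ en; rewrite /sigma (negbTE en) permM.
by rewrite !cycle_perm_labelsE //; have := ltn_ord i; do ?case: ifP; lia.
Qed.

(** Here [k] is the 0-based middle index, one less than the [k] inside [sigma]. The three cycles
    have disjoint supports, so at most one moves [i]. *)
Lemma sigma_oddE k (i : 'I_k.*2.+1) :
  sigma k.*2.+1 i = (if i < k then if i.+1 == k then 0 else i.+1
    else if i == k :> nat then k
    else if i == k.*2 :> nat then k.+1 else i.+1) :> nat.
Proof.
rewrite /sigma /= odd_double doubleK /= !permM.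
by rewrite !cycle_perm_labelsE; have := ltn_ord i; do ?case: ifP; lia.
Qed.

Theorem theorem4p1 (n : nat) (hn : (4 <= n)%N) :
  euler_magic (perm_mx (sigma n) : 'M[int]_n).
Proof.
have [on|en] := boolP (odd n).
  have [k def_n] : exists k, n = k.*2.+1 by exists n./2; lia.
  subst n; have hk : k < k.*2.+1 by lia.
  (* Since [n >= 4] gives [k >= 2], neither outer cycle has a fixed point. *)
  by apply: (@euler_magic_perm_mx _ _ _ (Ordinal hk) (Ordinal hk)) => i;
    rewrite -!val_eqE /= sigma_oddE; have := ltn_ord i; do ?case: ifP; lia.
have hx : n.-1 < n by lia.
(* The 0-based solution of [i + 1 = n - 1 - i]. *)
have hy : n./2.-1 < n by lia.
by apply: (@euler_magic_perm_mx _ _ _ (Ordinal hx) (Ordinal hy)) => i;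
  rewrite -!val_eqE /= sigma_evenE //; have := ltn_ord i; do ?case: ifP; lia.
Qed.
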